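(* Let $L\in(0,\infty)$ and $\rho\in\mathbb{R}$, and let $F:\mathbb{R}^d\to\mathbb{R}^d$ be a saddle-gradient operator that is $L$-Lipschitz continuous and $\rho$-comonotone. Let $\{z_k\}_{k\ge0}$, $\{\tau_k\}$, $\{\eta_k\}$ be generated by the FEG-A method (described in the context) from inputs $z_0\in\mathbb{R}^d$, $\tau_{-1}\in(\max\{0,-2\rho\},\infty)$, $\eta_0\in(0,\infty)$, $\delta\in(0,1)$. Then for any $z_*\in\mathbb{R}^d$ with $Fz_*=0$, and for every $k\ge1$ (for which iteration $k$ of FEG-A has been completed, so that $\tau_k,\eta_k$ are defined), if $\rho>-\frac{\tau_k}{2}$ then $$\|Fz_k\|^2 \le \frac{4\|z_0-z_*\|^2}{\left((k-1)\eta_k + \tau_k + 2\rho \right)^2}.$$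
   Context: Write $d=d_x+d_y$ and $z=(x,y)\in\mathbb{R}^{d_x}\times\mathbb{R}^{d_y}=\mathbb{R}^d$, with the Euclidean inner product and norm. For a continuously differentiable $f:\mathbb{R}^{d_x}\times\mathbb{R}^{d_y}\to\mathbb{R}$, its saddle-gradient operator is $F=(\nabla_x f,-\nabla_y f)$; $Fz$ denotes $F(z)$. $F$ is $L$-Lipschitz continuous if $\|Fz-Fz'\|\le L\|z-z'\|$ for all $z,z'$, and $\rho$-comonotone if $\langle Fz-Fz',z-z'\rangle\ge\rho\|Fz-Fz'\|^2$ for all $z,z'$. FEG-A method. Inputs: $z_0\in\mathbb{R}^d$, $\tau_{-1}\in(\max\{0,-2\rho\},\infty)$, $\eta_0\in(0,\infty)$, $\delta\in(0,1)$. Step 0: let $i_0$ be the smallest nonnegative integer such that $\hat z=z_0-\tau_{-1}(1-\delta)^{i_0}Fz_0$ satisfies $\|F\hat z-Fz_0\|\le\frac{1}{\tau_{-1}(1-\delta)^{i_0}}\|\hat z-z_0\|$. Set $\tau_0=\tau_{-1}(1-\delta)^{i_0}$ and $z_1=z_0-\tau_0Fz_0$. Iteration $k=1,2,\dots$: start with $i_k=j_k=0$ and repeat the following. With the current $i_k,j_k$ put $\tau_k=\tau_{k-1}(1-\delta)^{i_k}$, $\eta_k=\eta_{k-1}(1-\delta)^{j_k}$, and $$z_{k+1/2}=z_k+\tfrac1{k+1}(z_0-z_k)-\big(1-\tfrac1{k+1}\big)\eta_kFz_k,$$ $$z_{k+1}=z_k+\tfrac1{k+1}(z_0-z_k)-\tau_kFz_{k+1/2}-\big(1-\tfrac1{k+1}\big)(\eta_k-\tau_k)Fz_k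 .$$ If $\|Fz_{k+1}-Fz_{k+1/2}\|>\frac1{\tau_k}\|z_{k+1}-z_{k+1/2}\|$, increase $i_k$ by one. If $\langle Fz_{k+1}-Fz_k,z_{k+1}-z_k\rangle<\frac{\eta_k-\tau_k}{2}\|Fz_{k+1}-Fz_k\|^2$, increase $j_k$ by one. If neither inequality holds, iteration $k$ is completed: the current $\tau_k,\eta_k,z_{k+1}$ are accepted and the method proceeds to iteration $k+1$; otherwise repeat with the updated $i_k,j_k$. In the result, $\tau_k$ and $\eta_k$ denote the accepted values. *)

(* Defs.v *)
From mathcomp Require Import all_boot all_order all_algebra.
From mathcomp Require Import all_classical all_reals all_analysis.

Set Implicit Arguments.
Unset Strict Implicit.
Unset Printing Implicit Defensive.

Import Order.TTheory GRing.Theory Num.Theory.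
Import numFieldNormedType.Exports.

Local Open Scope classical_set_scope.
Local Open Scope ring_scope.

(* The library norm `|u| on row vectors is the sup norm, so the Euclidean
   structure is defined here.  The two norms are equivalent: differentiability
   and continuity below may use the library topology. *)
Definition dot (R : realType) (n : nat) (u v : 'rV[R]_n) : R :=
  \sum_(i < n) u 0 i * v 0 i.

Definition enorm (R : realType) (n : nat) (u : 'rV[R]_n) : R :=
  Num.sqrt (dot u u).

Definition elipschitz (R : realType) (n : nat) (L : R)
    (F : 'rV[R]_n -> 'rV[R]_n) : Prop :=
  forall z z', enorm (F z - F z') <= L * enorm (z - z').

Definition comonotone (R : realType) (n : nat) (rho : R)
    (F : 'rV[R]_n -> 'rV[R]_n) : Prop :=
  forall z z', dot (F z - F z') (z - z') >= rho * enorm (F z - F z') ^+ 2.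

Definition grad (R : realType) (n : nat) (g : 'rV[R]_n -> R) (x : 'rV[R]_n) :
    'rV[R]_n :=
  \row_(i < n) 'D_(delta_mx 0 i) g x.

Definition continuously_differentiable (R : realType) (n : nat)
    (g : 'rV[R]_n -> R) : Prop :=
  (forall x, differentiable g x) /\ continuous (grad g).

(* A point (x, y) of R^dx * R^dy is the row vector row_mx x y. *)
Definition joint (R : realType) (dx dy : nat)
    (f : 'rV[R]_dx -> 'rV[R]_dy -> R) (z : 'rV[R]_(dx + dy)) : R :=
  f (lsubmx z) (rsubmx z).

Definition saddle_gradient (R : realType) (dx dy : nat)
    (f : 'rV[R]_dx -> 'rV[R]_dy -> R) (z : 'rV[R]_(dx + dy)) :
    'rV[R]_(dx + dy) :=
  let x := lsubmx z in let y := rsubmx z in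
  row_mx (grad (f^~ y) x) (- grad (f x) y).

Definition is_saddle_gradient (R : realType) (dx dy : nat)
    (F : 'rV[R]_(dx + dy) -> 'rV[R]_(dx + dy)) : Prop :=
  exists f : 'rV[R]_dx -> 'rV[R]_dy -> R,
    continuously_differentiable (joint f) /\ F =1 saddle_gradient f.

Section FEGA.
Variables (R : realType) (n : nat) (F : 'rV[R]_n -> 'rV[R]_n).
Variables (z0 : 'rV[R]_n) (taum1 eta0 delta : R).

Definition trial_step (s : R) (i : nat) : R := s * (1 - delta) ^+ i.

Definition step0_accepts (i : nat) : bool :=
  let t := trial_step taum1 i in
  let zhat := z0 - t *: F z0 in
  enorm (F zhat - F z0) <= 1 / t * enorm (zhat - z0).

Definition fega_step0 (z : nat -> 'rV[R]_n) (tau eta : nat -> R) : Prop :=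
  [/\ z 0%N = z0,
      eta 0%N = eta0,
      (exists i0 : nat,
         [/\ step0_accepts i0,
             forall i : nat, (i < i0)%N -> ~~ step0_accepts i
           & tau 0%N = trial_step taum1 i0])
    & z 1%N = z0 - tau 0%N *: F z0].

Definition half_point (k : nat) (zk : 'rV[R]_n) (eta : R) : 'rV[R]_n :=
  zk + (1 / k.+1%:R) *: (z0 - zk) - ((1 - 1 / k.+1%:R) * eta) *: F zk.

Definition next_point (k : nat) (zk : 'rV[R]_n) (tau eta : R) : 'rV[R]_n :=
  zk + (1 / k.+1%:R) *: (z0 - zk) - tau *: F (half_point k zk eta)
     - ((1 - 1 / k.+1%:R) * (eta - tau)) *: F zk.

Definition tau_violated (k : nat) (zk : 'rV[R]_n) (tau eta : R) : bool :=
  let zh := half_point k zk eta in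
  let zn := next_point k zk tau eta in
  enorm (F zn - F zh) > 1 / tau * enorm (zn - zh).

Definition eta_violated (k : nat) (zk : 'rV[R]_n) (tau eta : R) : bool :=
  let zn := next_point k zk tau eta in
  dot (F zn - F zk) (zn - zk) < (eta - tau) / 2 * enorm (F zn - F zk) ^+ 2.

(* One pass of the inner loop on the counters (i_k, j_k), where taup and etap
   are the values accepted at iteration k - 1.  Both tests are evaluated at the
   incoming counters; booleans are coerced to 0 or 1. *)
Definition backtrack (k : nat) (zk : 'rV[R]_n) (taup etap : R)
    (c : nat * nat) : nat * nat :=
  let t := trial_step taup c.1 in
  let e := trial_step etap c.2 in
  (c.1 + tau_violated k zk t e, c.2 + eta_violated k zk t e)%N.

Definition fega_iteration (k : nat) (z : nat -> 'rV[R]_n) (tau eta : nat -> R) :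
    Prop :=
  exists passes : nat,
    let c := iter passes (backtrack k (z k) (tau k.-1) (eta k.-1)) (0, 0)%N in
    [/\ tau k = trial_step (tau k.-1) c.1,
        eta k = trial_step (eta k.-1) c.2,
        ~~ tau_violated k (z k) (tau k) (eta k),
        ~~ eta_violated k (z k) (tau k) (eta k)
      & z k.+1 = next_point k (z k) (tau k) (eta k)].

(* The method has completed step 0 and iterations 1, ..., K, producing
   z 0, ..., z K.+1, tau 0, ..., tau K and eta 0, ..., eta K; later entries of
   the three sequences are irrelevant.  The inner loop is not assumed to
   terminate at iterations beyond K. *)
Definition fega_completed (K : nat) (z : nat -> 'rV[R]_n) (tau eta : nat -> R) :
    Prop :=
  fega_step0 z tau eta /\
  forall k : nat, (1 <= k <= K)%N -> fega_iteration k z tau eta.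

End FEGA.

(* Main.v *)
Require Import Defs.
From mathcomp Require Import all_boot all_order all_algebra.
From mathcomp Require Import all_classical all_reals all_analysis.
From mathcomp Require Import ring lra.

(** The potential
      V_k(t, e) = k ((k - 1) e + t) / 2 |F z_k|^2 - k <F z_k, z_0 - z_k>
    satisfies V_1(tau_0, eta_0) <= 0 by the test of step 0, and
    V_{k+1}(tau_k, eta_k) <= V_k(tau_k, eta_k) is a positive combination of the
    two tests accepted at iteration k.  Since tau and eta are positive and
    nonincreasing, V_k(tau_k, eta_k) <= V_k(tau_{k-1}, eta_{k-1}), so
    V_k(tau_k, eta_k) <= 0 for all k >= 1.  Comonotonicity at [zs] and
    Young's inequality turn this into the stated bound. *)

Set Implicit Arguments.
Unset Strict Implicit.

Import Order.TTheory GRing.Theory Num.Theory.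
Import numFieldNormedType.Exports.

Local Open Scope ring_scope.

Section EuclideanProduct.
Variables (R : realType) (n : nat).
Implicit Types u v w : 'rV[R]_n.

Lemma dotC u v : dot u v = dot v u.
Proof. by apply: eq_bigr => i _; rewrite mulrC. Qed.

Lemma dotDl u v w : dot (u + v) w = dot u w + dot v w.
Proof. by rewrite -big_split; apply: eq_bigr => i _; rewrite mxE mulrDl. Qed.

Lemma dotZl a u v : dot (a *: u) v = a * dot u v.
Proof. by rewrite /dot mulr_sumr; apply: eq_bigr => i _; rewrite mxE mulrA. Qed.

Lemma dotNl u v : dot (- u) v = - dot u v.
Proof. by rewrite -scaleN1r dotZl mulN1r. Qed.

Lemma dotDr u v w : dot u (v + w) = dot u v + dot u w.
Proof. by rewrite dotC dotDl !(dotC _ u). Qed.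

Lemma dotZr a u v : dot u (a *: v) = a * dot u v.
Proof. by rewrite dotC dotZl dotC. Qed.

Lemma dotNr u v : dot u (- v) = - dot u v.
Proof. by rewrite dotC dotNl dotC. Qed.

Definition dotE := (dotDl, dotDr, dotNl, dotNr, dotZl, dotZr).

Lemma dot_ge0 u : 0 <= dot u u.
Proof. by apply: sumr_ge0 => i _; rewrite -expr2 sqr_ge0. Qed.

Lemma enorm_sqr u : enorm u ^+ 2 = dot u u.
Proof. by rewrite sqr_sqrtr ?dot_ge0. Qed.

Lemma enormZ a u : 0 <= a -> enorm (a *: u) = a * enorm u.
Proof.
move=> a0; rewrite /enorm !dotE mulrA sqrtrM ?mulr_ge0//.
by rewrite -expr2 sqrtr_sqr ger0_norm.
Qed.

Lemma enormN u : enorm (- u) = enorm u.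
Proof. by rewrite /enorm !dotE opprK. Qed.

Lemma ler_enorm_dot u v : enorm u <= enorm v -> dot u u <= dot v v.
Proof. by rewrite ler_sqrt ?dot_ge0. Qed.

(* Replaces Cauchy-Schwarz: the theorem needs it only for one fixed [c]. *)
Lemma dot_young c u v : 2 * c * dot u v <= c ^+ 2 * dot u u + dot v v.
Proof.
have := dot_ge0 (c *: u - v); rewrite !dotE (dotC v u); lra.
Qed.

End EuclideanProduct.

Section Potential.
Variables (R : realType) (n : nat) (F : 'rV[R]_n -> 'rV[R]_n) (z0 : 'rV[R]_n).
Implicit Types (x : 'rV[R]_n) (t e : R).

Definition potential (k : nat) x t e : R :=
  k%:R * ((k%:R - 1) * e + t) / 2 * dot (F x) (F x)
  - k%:R * dot (F x) (z0 - x).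

Lemma potential_mono k x t e t' e' : (1 <= k)%N -> t' <= t -> e' <= e ->
  potential k x t' e' <= potential k x t e.
Proof.
move=> k1 le_t le_e; rewrite lerD2r ler_wpM2r ?dot_ge0//.
rewrite ler_wpM2r ?invr_ge0// ler_wpM2l// lerD// ler_wpM2l//.
by rewrite subr_ge0 ler1n.
Qed.

(** With [x] the new point, the factor [t] cancels from the test, and squaring leaves
    [|F x|^2 <= 2 <F x, F z0>]. At index 1 the coefficient of [e] is 0, so [e] is arbitrary. *)
Lemma potential_step0 delta taum1 i e : 0 < trial_step delta taum1 i ->
  step0_accepts F z0 taum1 delta i ->
  potential 1 (z0 - trial_step delta taum1 i *: F z0)
    (trial_step delta taum1 i) e <= 0.
Proof.
rewrite /step0_accepts /potential; set t := trial_step _ _ _ => t0.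
set x := z0 - t *: F z0.
have -> : x - z0 = - (t *: F z0) by rewrite /x addrAC subrr sub0r.
have -> : z0 - x = t *: F z0 by rewrite /x opprB addrC subrK.
rewrite enormN (enormZ _ (ltW t0)) mulrA mul1r mulVf ?gt_eqF// mul1r.
move=> /ler_enorm_dot; rewrite !dotE (dotC (F z0) (F x)) => h.
have : 0 <= t * (2 * dot (F x) (F z0) - dot (F x) (F x)).
  by apply: mulr_ge0; lra.
lra.
Qed.

Lemma potential_step k x t e : (1 <= k)%N -> 0 < t ->
  ~~ tau_violated F z0 k x t e -> ~~ eta_violated F z0 k x t e ->
  potential k.+1 (next_point F z0 k x t e) t e <= potential k x t e.
Proof.
move=> k1 t0; rewrite /tau_violated /eta_violated -!leNgt /potential /=.
set h := half_point _ _ _ _ _; set y := next_point _ _ _ _ _ _.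
set b : R := 1 / k.+1%:R.
(* The anchor terms [z0 - x] cancel, so the [tau] test compares operator values only:
   [|F y - F h| <= |(1 - b) F x - F h|]. *)
have -> : y - h = t *: ((1 - b) *: F x - F h).
  rewrite /y /next_point -/h -/b {2}/h /half_point -/b.
  by apply/rowP => i; rewrite !mxE; ring.
have -> : y - x = b *: (z0 - x) - t *: F h - ((1 - b) * (e - t)) *: F x.
  rewrite /y /next_point -/h -/b.
  by apply/rowP => i; rewrite !mxE; ring.
have -> : z0 - y = (1 - b) *: (z0 - x) + t *: F h + ((1 - b) * (e - t)) *: F x.
  rewrite /y /next_point -/h -/b.
  by apply/rowP => i; rewrite !mxE; ring.
rewrite (enormZ _ (ltW t0)) mulrA mul1r mulVf ?gt_eqF// mul1r => /ler_enorm_dot.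
rewrite enorm_sqr; set d := z0 - x.
rewrite !dotE (dotC (F h) (F y)) (dotC (F h) (F x)) (dotC (F x) (F y)).
have K0 : (0 : R) <= k%:R by [].
rewrite /b -natr1; move: (k%:R : R) K0 => K K0 tau_ok eta_ok.
rewrite -subr_le0 in tau_ok; rewrite -subr_le0 in eta_ok.
have K1 : K + 1 != 0 by lra.
rewrite -subr_le0.
(* The ratio of the two weights cancels [<F x, F h>], which occurs in neither potential; their scale
   matches the term [-(K + 1) t <F y, F h>] coming from [-(K + 1) <F y, z0 - y>]. The weighted sum
   then equals the change of potential exactly. *)
have c1 : 0 <= (K + 1) ^+ 2 * t / 2.
  by rewrite divr_ge0// mulr_ge0 ?sqr_ge0 ?ltW.
have c2 : 0 <= K * (K + 1) by rewrite mulr_ge0 ?addr_ge0.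
have := lerD (mulr_ge0_le0 c1 tau_ok) (mulr_ge0_le0 c2 eta_ok).
rewrite addr0; apply: le_trans; rewrite le_eqVlt; apply/orP; left; apply/eqP.
by field.
Qed.

End Potential.

Section Run.
Variables (R : realType) (n : nat) (F : 'rV[R]_n -> 'rV[R]_n).
Variables (z0 : 'rV[R]_n) (taum1 eta0 delta : R).
Hypotheses (taum1_gt0 : 0 < taum1) (eta0_gt0 : 0 < eta0).
Hypotheses (delta_gt0 : 0 < delta) (delta_lt1 : delta < 1).

Lemma trial_step_gt0 s i : 0 < s -> 0 < trial_step delta s i.
Proof. by move=> s0; rewrite mulr_gt0// exprn_gt0// subr_gt0. Qed.

Lemma trial_step_le s i : 0 < s -> trial_step delta s i <= s.
Proof.
by move=> /ltW s0; rewrite ler_piMr// exprn_ile1//;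
  move: delta_gt0 delta_lt1; lra.
Qed.

(** The potential of [z k.+1] is taken at the step sizes that produced this point, as
    [potential_step] delivers it. Positivity is carried along because shrinking a step size lowers
    the potential only from a positive value. *)
Lemma fega_potential_le0 K z tau eta :
  fega_completed F z0 taum1 eta0 delta K z tau eta ->
  forall k, (k <= K)%N ->
  [/\ 0 < tau k, 0 < eta k & potential F z0 k.+1 (z k.+1) (tau k) (eta k) <= 0].
Proof.
move=> [[_ eta0E [i0 [ok0 _ tau0E]] z1E] run].
elim=> [_|k IH kK].
  rewrite z1E tau0E eta0E; split=> //; first exact: trial_step_gt0.
  by apply: potential_step0 => //; exact: trial_step_gt0.
have [tau_gt0 eta_gt0 pot] := IH (ltnW kK).
have [|p /= [tauE etaE tau_ok eta_ok zE]] := run k.+1; first by rewrite kK.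
have tauS_gt0 : 0 < tau k.+1 by rewrite tauE trial_step_gt0.
split=> //; first by rewrite etaE trial_step_gt0.
rewrite zE.
have step := potential_step (ltn0Sn k) tauS_gt0 tau_ok eta_ok.
apply: le_trans step (le_trans _ pot); apply: potential_mono => //.
  by rewrite tauE trial_step_le.
by rewrite etaE trial_step_le.
Qed.

(** Passes from the step sizes that produced [z K] to the smaller ones accepted at iteration [K],
    which appear in the final bound. *)
Lemma fega_current_potential_le0 K z tau eta : (1 <= K)%N ->
  fega_completed F z0 taum1 eta0 delta K z tau eta ->
  [/\ 0 < eta K & potential F z0 K (z K) (tau K) (eta K) <= 0].
Proof.
case: K => // k _ run; have pot := fega_potential_le0 run.
have [tau_gt0 eta_gt0 le0] := pot k (leqnSn k).
have [_ etaS_gt0 _] := pot k.+1 (leqnn _).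
split=> //; apply: le_trans le0; case: run => _ run.
have [|p /= [-> -> _ _ _]] := run k.+1; first by rewrite leqnn.
by apply: potential_mono => //; exact: trial_step_le.
Qed.

End Run.

Unset Implicit Arguments.
Set Strict Implicit.

Theorem theorem5p1 (R : realType) (dx dy : nat) (L rho : R)
    (F : 'rV[R]_(dx + dy) -> 'rV[R]_(dx + dy))
    (L_gt0 : 0 < L)
    (F_saddle : is_saddle_gradient F)
    (F_lip : elipschitz L F)
    (F_com : comonotone rho F)
    (z0 : 'rV[R]_(dx + dy)) (taum1 eta0 delta : R)
    (taum1_gt : Num.max 0 (- 2 * rho) < taum1)
    (eta0_gt0 : 0 < eta0)
    (delta_gt0 : 0 < delta) (delta_lt1 : delta < 1)
    (z : nat -> 'rV[R]_(dx + dy)) (tau eta : nat -> R)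
    (zs : 'rV[R]_(dx + dy)) (F_zs : F zs = 0)
    (k : nat) (k_ge1 : (1 <= k)%N)
    (run : fega_completed F z0 taum1 eta0 delta k z tau eta)
    (rho_gt : - (tau k / 2) < rho) :
  enorm (F (z k)) ^+ 2 <=
    4 * enorm (z0 - zs) ^+ 2 / ((k%:R - 1) * eta k + tau k + 2 * rho) ^+ 2.
Proof.
have taum1_gt0 : 0 < taum1 by move: taum1_gt; rewrite gt_max => /andP[].
have [eta_gt0] := fega_current_potential_le0 taum1_gt0 eta0_gt0 delta_gt0
  delta_lt1 k_ge1 run.
rewrite /potential -mulrA -mulrA -mulrBr pmulr_rle0 ?ltr0n// => pot.
have := F_com (z k) zs; rewrite F_zs subr0 !enorm_sqr => com.
(* The part [z k - zs] is bounded by comonotonicity, which adds [2 * rho] to the coefficient of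
   [|F (z k)|^2 / 2]. *)
have split_z0 : z0 - z k = (z0 - zs) - (z k - zs) by rewrite opprB addrA subrK.
rewrite split_z0 dotDr dotNr in pot.
set c := (k%:R - 1) * eta k + tau k + 2 * rho.
have c_gt0 : 0 < c.
  have : 0 <= (k%:R - 1) * eta k by rewrite mulr_ge0 ?subr_ge0 ?ler1n ?ltW.
  by rewrite /c; lra.
rewrite ler_pdivlMr ?exprn_gt0//.
(* With [c / 2], Young absorbs half of [c^2 / 2 * |F (z k)|^2 <= c <F (z k), z0 - zs>], leaving
   [c^2 / 4 * |F (z k)|^2 <= |z0 - zs|^2]. *)
have young := dot_young (c / 2) (F (z k)) (z0 - zs).
have : c * (c / 2 * dot (F (z k)) (F (z k))) <= c * dot (F (z k)) (z0 - zs).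
  by rewrite ler_pM2l// /c; lra.
lra.
Qed.
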